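(* Let $\mathcal{F}$ be a finite frieze of positive integers. Then its growth sequence $(s_0,s_1,s_2,\dots)$ is one of the following (each continued periodically): $$(2,-2,2,-2,2,-2,\dots),\qquad (2,0,-2,0,2,0,-2,\dots),\qquad (2,1,-1,-2,-1,1,2,1,\dots).$$ (The periods are $2$, $4$ and $6$ respectively.) The first of these growth sequences arises precisely when the associated triangulation has no rotational symmetry. The second and third respectively arise from triangulations with $180$ degree and $120$ degree rotational symmetry.
   Context: A finite frieze of positive integers of order $n\ge3$ is an array $(m_{i,j})$ indexed by $i\in\mathbb{Z}$, $-2\le j-i\le n-2$, with $m_{i,i-2}=m_{i,i+n-2}=0$, $m_{i,i-1}=m_{i,i+n-3}=1$, with all entries with $-1\le j-i\le n-3$ positive integers, and with $m_{i,j}m_{i+1,j+1}-m_{i,j+1}m_{i+1,j}=1$ whenever all four entries lie in the array. Such a frieze is $n$-periodic ($m_{i+n,j+n}=m_{i,j}$). By Conway and Coxeter it corresponds to a triangulation of a convex $n$-gon: $a_i=m_{i,i}$, $i=1,\dots,n$, is the number of triangles incident with vertex $i$ of the triangulation (vertices taken in anti-clockwise order); this is the associated triangulation. Rotational symmetry refers to non-trivial rotations of the regular $n$-gon preserving the triangulation. The lattice of the frieze is the unique extension $(m_{i,j})_{i,j\in\mathbb{Z}}$ of the array satisfying $m_{i,j}=-m_{j+2,i-2}$ and $m_{i,j}=-m_{j-n+2,i+n-2}$ for all $i,j\in\mathbb{Z}$ (anti-symmetric mirroring across the rows of zeros). The growth sequence is $(s_k)_{k\ge0}$ with $s_0:=2$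 and $s_k:=m_{1,kp}-m_{2,kp-1}$ for $k\ge1$, where $p$ is the minimal period of the frieze, i.e. the least $p\ge1$ with $m_{i+p,j+p}=m_{i,j}$ for all entries. *)

(* Defs.v *)
From mathcomp Require Import all_boot all_order all_algebra zify ring.
From mathcomp Require Import boolp.

Set Implicit Arguments.
Unset Strict Implicit.
Unset Printing Implicit Defensive.

Import Order.TTheory GRing.Theory Num.Theory.
Local Open Scope ring_scope.

(** * Finite friezes *)

Definition in_strip (n : nat) (i j : int) : bool := -2 <= j - i <= n%:Z - 2.

(* [entry] is a total function, but only its values on the strip are
   constrained, and nothing below depends on its values elsewhere. *)
Record frieze (n : nat) := Frieze {
  entry :> int -> int -> int;
  order_ge3 : (3 <= n)%N;
  entry_zerol : forall i : int, entry i (i - 2) = 0;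
  entry_zeror : forall i : int, entry i (i + n%:Z - 2) = 0;
  entry_onel : forall i : int, entry i (i - 1) = 1;
  entry_oner : forall i : int, entry i (i + n%:Z - 3) = 1;
  entry_gt0 : forall i j : int, -1 <= j - i <= n%:Z - 3 -> 0 < entry i j;
  entry_sl2 : forall i j : int,
    in_strip n i j -> in_strip n (i + 1) (j + 1) ->
    in_strip n i (j + 1) -> in_strip n (i + 1) j ->
    entry i j * entry (i + 1) (j + 1) - entry i (j + 1) * entry (i + 1) j = 1
}.

Definition frieze_period (n : nat) (F : frieze n) (p : nat) : Prop :=
  forall i j : int, in_strip n i j -> F (i + p%:Z) (j + p%:Z) = F i j.

Section Periodicity.
Variables (n : nat) (F : frieze n).

Lemma frieze_row_rec (i j : int) : -1 <= j - i <= n%:Z - 3 ->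
  F i (j + 1) + F i (j - 1) = F (j + 1) (j + 1) * F i j.
Proof.
move=> Hij; have [t Ht] : exists t : nat, j = i - 1 + t%:Z.
  by exists (absz (j - i + 1)%R); lia.
elim: t i Ht Hij => [|t IH] i Ht Hij.
  have -> : j = i - 1 by lia.
  have -> : i - 1 - 1 = i - 2 by lia.
  by rewrite subrK entry_zerol entry_onel addr0 mulr1.
have IH1 : F (i + 1) (j + 1) + F (i + 1) (j - 1)
    = F (j + 1) (j + 1) * F (i + 1) j by apply: IH; lia.
have E1 : F i j * F (i + 1) (j + 1) - F i (j + 1) * F (i + 1) j = 1.
  by apply: entry_sl2; rewrite /in_strip; lia.
have E2 : F i (j - 1) * F (i + 1) j - F i j * F (i + 1) (j - 1) = 1.
  have := @entry_sl2 n F i (j - 1); rewrite !subrK; apply;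
  by rewrite /in_strip; lia.
have P : F (i + 1) j != 0 by rewrite gt_eqF // entry_gt0 //; lia.
apply: (mulIf P).
have -> : F (j + 1) (j + 1) * F i j * F (i + 1) j
  = F i j * (F (j + 1) (j + 1) * F (i + 1) j) by ring.
by rewrite -IH1; lia.
Qed.

Lemma frieze_col_rec (i j : int) : -1 <= j - i <= n%:Z - 3 ->
  F (i - 1) j + F (i + 1) j = F (i - 1) (i - 1) * F i j.
Proof.
move=> Hij; have [t Ht] : exists t : nat, j = i - 1 + t%:Z.
  by exists (absz (j - i + 1)%R); lia.
elim: t j Ht Hij => [|t IH] j Ht Hij.
  have -> : j = i - 1 by lia.
  have -> : F (i + 1) (i - 1) = 0.
    by have -> : i - 1 = i + 1 - 2 by [lia]; exact: entry_zerol.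
  by rewrite entry_onel addr0 mulr1.
have IH1 : F (i - 1) (j - 1) + F (i + 1) (j - 1)
    = F (i - 1) (i - 1) * F i (j - 1) by apply: IH; lia.
have E1 : F (i - 1) (j - 1) * F i j - F (i - 1) j * F i (j - 1) = 1.
  have := @entry_sl2 n F (i - 1) (j - 1); rewrite !subrK; apply;
  by rewrite /in_strip; lia.
have E2 : F i (j - 1) * F (i + 1) j - F i j * F (i + 1) (j - 1) = 1.
  have := @entry_sl2 n F i (j - 1); rewrite !subrK; apply;
  by rewrite /in_strip; lia.
have P : F i (j - 1) != 0 by rewrite gt_eqF // entry_gt0 //; lia.
apply: (mulIf P).
have -> : F (i - 1) (i - 1) * F i j * F i (j - 1)
  = F i j * (F (i - 1) (i - 1) * F i (j - 1)) by ring.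
by rewrite -IH1; lia.
Qed.

Lemma frieze_glide (i j : int) : in_strip n i j ->
  F i j = F (j + 2) (i + n%:Z - 2).
Proof.
rewrite /in_strip => Hij; have n3 := order_ge3 F.
have [t Ht] : exists t : nat, j = i + n%:Z - 2 - t%:Z.
  by exists (absz (i + n%:Z - 2 - j)%R); lia.
elim/ltn_ind: t j Ht Hij => -[|[|t]] IH j Ht Hij.
- have -> : j = i + n%:Z - 2 by lia.
  have := entry_zerol F (i + n%:Z - 2 + 2); rewrite addrK => ->.
  exact: entry_zeror.
- have -> : j = i + n%:Z - 3 by lia.
  have e : i + n%:Z - 3 + 2 - 1 = i + n%:Z - 2 by lia.
  by have := entry_onel F (i + n%:Z - 3 + 2); rewrite e entry_oner => ->.
have IH1 := IH t.+1 (ltnSn _) (j + 1) ltac:(lia) ltac:(lia).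
have IH2 := IH t (leqnSn _) (j + 2) ltac:(lia) ltac:(lia).
have R := @frieze_row_rec i (j + 1) ltac:(lia).
have C := @frieze_col_rec (j + 3) (i + n%:Z - 2) ltac:(lia).
have e1 : j + 1 + 1 = j + 2 by lia.
have e2 : j + 1 + 2 = j + 3 by lia.
have e3 : j + 2 + 2 = j + 4 by lia.
have e4 : j + 3 - 1 = j + 2 by lia.
have e5 : j + 3 + 1 = j + 4 by lia.
rewrite e1 addrK in R; rewrite e2 in IH1; rewrite e3 in IH2.
rewrite e4 e5 in C; rewrite IH1 IH2 in R; lia.
Qed.

Lemma frieze_periodic : frieze_period F n.
Proof.
move=> i j Hij; rewrite (frieze_glide Hij).
rewrite [RHS]frieze_glide; last by move: Hij; rewrite /in_strip; lia.
by congr (F _ _); lia.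
Qed.

End Periodicity.

Lemma has_frieze_period (n : nat) (F : frieze n) :
  exists p, (0 < p)%N && `[< frieze_period F p >].
Proof.
exists n; rewrite (leq_trans _ (order_ge3 F)) //=.
by apply/asboolP/frieze_periodic.
Qed.

Definition min_period (n : nat) (F : frieze n) : nat :=
  ex_minn (has_frieze_period F).

(** * The lattice of a frieze and its growth sequence *)

Record is_lattice (n : nat) (F : frieze n) (M : int -> int -> int) : Prop :=
  IsLattice {
  lattice_strip : forall i j, in_strip n i j -> M i j = F i j;
  lattice_mirrorl : forall i j, M i j = - M (j + 2) (i - 2);
  lattice_mirrorr : forall i j, M i j = - M (j - n%:Z + 2) (i + n%:Z - 2)
}.

(* The composite of the two mirror symmetries is the translation
   (i, j) |-> (i - n, j + n); it is used to move (i, j) to a pair with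
   -2 <= j - i <= 2n - 3, where at most one more reflection is needed. The
   lemmas [lattice_is_lattice] and [is_lattice_unique] show that the result is
   the unique function satisfying [is_lattice]. *)
Definition lattice (n : nat) (F : frieze n) (i j : int) : int :=
  let q := ((j - i + 2) %/ (n.*2)%:Z)%Z in
  let i' := i + q * n%:Z in
  let j' := j - q * n%:Z in
  if in_strip n i' j' then F i' j' else - F (j' - n%:Z + 2) (i' + n%:Z - 2).

Section Lattice.
Variables (n : nat) (F : frieze n).

Lemma lattice_eq (q i j : int) : -2 <= j - i <= (n.*2)%:Z - 3 ->
  lattice F (i - q * n%:Z) (j + q * n%:Z) =
  if in_strip n i j then F i j else - F (j - n%:Z + 2) (i + n%:Z - 2).
Proof.
move=> H; have n3 := order_ge3 F.
have E : ((j + q * n%:Z - (i - q * n%:Z) + 2) %/ (n.*2)%:Z)%Z = q.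
  have -> : j + q * n%:Z - (i - q * n%:Z) + 2
     = q * (n.*2)%:Z + (j - i + 2) by rewrite -muln2 PoszM; ring.
  by rewrite divzMDl ?divz_small ?addr0 //; lia.
by rewrite /lattice E subrK addrK.
Qed.

Lemma lattice_normal (i j : int) : exists q i' j' : int,
  [/\ i = i' - q * n%:Z, j = j' + q * n%:Z & -2 <= j' - i' <= (n.*2)%:Z - 3].
Proof.
have n3 := order_ge3 F.
pose q := ((j - i + 2) %/ (n.*2)%:Z)%Z.
exists q, (i + q * n%:Z), (j - q * n%:Z); split; [ring | ring |].
have := divz_eq (j - i + 2) (n.*2)%:Z; rewrite -/q.
have := @modz_ge0 (j - i + 2) (n.*2)%:Z ltac:(lia).
have := @ltz_pmod (j - i + 2) (n.*2)%:Z ltac:(lia).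
move: (_ %% _)%Z => r H1 H2 H3.
have e : q * (n.*2)%:Z = 2 * (q * n%:Z) by rewrite -muln2 PoszM; ring.
by rewrite e in H3; move: (q * n%:Z) H3 => x; lia.
Qed.

Lemma lattice_mirrorr_aux (i j : int) :
  lattice F i j = - lattice F (j - n%:Z + 2) (i + n%:Z - 2).
Proof.
have n3 := order_ge3 F.
have [q [i' [j' [-> -> H]]]] := lattice_normal i j; rewrite lattice_eq //.
case: ifPn => Hs; last first.
  have -> : j' + q * n%:Z - n%:Z + 2 = (j' - n%:Z + 2) - (- q) * n%:Z by ring.
  have -> : i' - q * n%:Z + n%:Z - 2 = (i' + n%:Z - 2) + (- q) * n%:Z by ring.
  move: Hs; rewrite /in_strip => Hs.
  by rewrite lattice_eq ?ifT /in_strip //; lia.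
have [e|ne] := eqVneq (j' - i') (-2).
  have -> : j' + q * n%:Z - n%:Z + 2 = i' - (1 - q) * n%:Z.
    by have -> : j' = i' - 2 by [lia]; ring.
  have -> : i' - q * n%:Z + n%:Z - 2 = j' + (1 - q) * n%:Z.
    by have -> : j' = i' - 2 by [lia]; ring.
  rewrite lattice_eq // Hs.
  by have -> : j' = i' - 2 by [lia]; rewrite entry_zerol oppr0.
have -> : j' + q * n%:Z - n%:Z + 2 = (j' - n%:Z + 2) - (- q) * n%:Z by ring.
have -> : i' - q * n%:Z + n%:Z - 2 = (i' + n%:Z - 2) + (- q) * n%:Z by ring.
move: Hs; rewrite /in_strip => Hs; rewrite lattice_eq; last by lia.
rewrite /in_strip; case: ifPn => Hs'; last first.
  rewrite opprK; congr (F _ _); lia.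
have ej : j' = i' + n%:Z - 2 by lia.
have -> : j' - n%:Z + 2 = i' by lia.
by rewrite -ej ej entry_zeror oppr0.
Qed.

Lemma lattice_shift (i j : int) :
  lattice F (i - n%:Z) (j + n%:Z) = lattice F i j.
Proof.
have [q [i' [j' [-> -> H]]]] := lattice_normal i j; rewrite lattice_eq //.
have -> : i' - q * n%:Z - n%:Z = i' - (q + 1) * n%:Z by ring.
have -> : j' + q * n%:Z + n%:Z = j' + (q + 1) * n%:Z by ring.
by rewrite lattice_eq.
Qed.

Lemma lattice_is_lattice : is_lattice F (lattice F).
Proof.
have n3 := order_ge3 F.
split=> [i j Hij | i j | i j]; last exact: lattice_mirrorr_aux.
  have := @lattice_eq 0 i j; rewrite mul0r subr0 addr0 Hij; apply.
  by move: Hij; rewrite /in_strip; lia.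
rewrite lattice_mirrorr_aux -[in RHS]lattice_shift.
by congr (- lattice F _ _); lia.
Qed.

Lemma is_lattice_shift M : is_lattice F M ->
  forall q i j : int, M (i - q * n%:Z) (j + q * n%:Z) = M i j.
Proof.
move=> HM.
have S i j : M (i - n%:Z) (j + n%:Z) = M i j.
  rewrite [RHS](lattice_mirrorl HM) (lattice_mirrorr HM).
  by congr (- M _ _); lia.
have SN (k : nat) i j : M (i - k%:Z * n%:Z) (j + k%:Z * n%:Z) = M i j.
  elim: k => [|k IH]; first by rewrite mul0r subr0 addr0.
  rewrite -[RHS]IH -[RHS]S; congr (M _ _); rewrite intS; ring.
move=> q i j; case: (intP q) => [|k|k]; first exact: (SN 0%N).
- exact: SN.
- rewrite -[LHS](SN k.+1); congr (M _ _); ring.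
Qed.

Lemma is_lattice_unique M i j : is_lattice F M -> M i j = lattice F i j.
Proof.
move=> HM; have [q [i' [j' [-> -> H]]]] := lattice_normal i j.
rewrite is_lattice_shift // lattice_eq //; case: ifPn => Hs.
  by rewrite (lattice_strip HM).
rewrite (lattice_mirrorr HM) (lattice_strip HM) //.
by move: Hs; rewrite /in_strip; lia.
Qed.

End Lattice.

Definition growth_sequence (n : nat) (F : frieze n) (k : nat) : int :=
  if k is 0%N then 2
  else lattice F 1 (k%:Z * (min_period F)%:Z)
       - lattice F 2 (k%:Z * (min_period F)%:Z - 1).

(** * Triangulations of a convex polygon *)

(* The vertices of the n-gon are the elements of 'I_n in anti-clockwise order,
   [ordS] being the anti-clockwise successor. Segments joining two vertices are
   two-element subsets of 'I_n. *)

Definition polygon_side (n : nat) (e : {set 'I_n}) : bool :=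
  [exists v : 'I_n, e == [set v; ordS v]].

Definition diagonal (n : nat) (e : {set 'I_n}) : bool :=
  (#|e| == 2%N) && ~~ polygon_side e.

(* Two segments cross (in an interior point) exactly when their four endpoints
   are distinct and alternate around the polygon. *)
Definition crossing (n : nat) (e f : {set 'I_n}) : bool :=
  [exists a : 'I_n, exists b : 'I_n, exists c : 'I_n, exists d : 'I_n,
     [&& (a < b)%N, (b < c)%N, (c < d)%N &
         (e == [set a; c]) && (f == [set b; d])
      || (e == [set b; d]) && (f == [set a; c])]].

Definition noncrossing_diagonals (n : nat) (D : {set {set 'I_n}}) : bool :=
  [forall e in D, diagonal e]
  && [forall e in D, forall f in D, ~~ crossing e f].

Definition triangulation (n : nat) (T : {set {set 'I_n}}) : bool :=
  maxset (@noncrossing_diagonals n) T.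

(* Since the vertices are in convex position and the diagonals of T do not
   cross, any three vertices pairwise joined by sides or diagonals of T bound a
   face of the triangulation. *)
Definition triangles (n : nat) (T : {set {set 'I_n}}) : {set {set 'I_n}} :=
  [set t : {set 'I_n} | (#|t| == 3%N) &&
     [forall x in t, forall y in t,
        (x != y) ==> (polygon_side [set x; y] || ([set x; y] \in T))]].

Definition triangles_at (n : nat) (T : {set {set 'I_n}}) (v : 'I_n) : nat :=
  #|[set t in triangles T | v \in t]|.

(* The element v of 'I_n stands for the vertex numbered v + 1. *)
Definition associated_triangulation (n : nat) (F : frieze n)
    (T : {set {set 'I_n}}) : Prop :=
  triangulation T /\
  forall v : 'I_n, F (v.+1)%:Z (v.+1)%:Z = (triangles_at T v)%:Z.

(* Rotation by k steps, that is, through 360 * k / n degrees. *)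
Definition rotate_triangulation (n k : nat) (T : {set {set 'I_n}}) :
    {set {set 'I_n}} :=
  [set [set iter k (@ordS n) v | v in e] | e : {set 'I_n} in T].

Definition no_rotational_symmetry (n : nat) (T : {set {set 'I_n}}) : Prop :=
  forall k : nat, (0 < k < n)%N -> rotate_triangulation k T <> T.

(* Symmetry under the rotation through 360 / d degrees; when d does not divide
   n, this rotation is not a rotation of the n-gon. *)
Definition rotational_symmetry (n d : nat) (T : {set {set 'I_n}}) : Prop :=
  exists k : nat, (d * k = n)%N /\ rotate_triangulation k T = T.

(** * Periodic sequences *)

Definition repeat_seq (l : seq int) (k : nat) : int := nth 0 l (k %% size l).

Definition growth2 : nat -> int := repeat_seq [:: 2; -2].
Definition growth4 : nat -> int := repeat_seq [:: 2; 0; -2; 0].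
Definition growth6 : nat -> int := repeat_seq [:: 2; 1; -1; -2; -1; 1].

(* Main.v *)
(** Let p be the minimal period and d = n / p. The lattice rows solve a
    recurrence with p-periodic coefficients, so by Cayley-Hamilton their values at steps of p satisfy
    x(k+1) = t x(k) - x(k-1), t being the trace of the monodromy matrix; the
    growth sequence satisfies this too, with s_1 = t. Since x(k) = m(1, kp - 1)
    vanishes at k = 0, d and is positive in between, (d, t) is one of (1, -2),
    (2, 0), (3, 1).

    A rotation by k steps preserves the triangulation exactly when k is a period
    of the frieze: the sides and diagonals of the triangulation have frieze
    entry 1 (by cutting off subpolygons), and by Ptolemy's relation two crossing
    diagonals cannot both have entry 1, so by maximality the triangulation
    consists of the diagonals with entry 1. *)
Require Import Defs.
From mathcomp Require Import all_boot all_order all_algebra.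
From mathcomp Require Import zify ring boolp.

Set Implicit Arguments.
Unset Strict Implicit.
Unset Printing Implicit Defensive.

Import Order.TTheory GRing.Theory Num.Theory.
Local Open Scope ring_scope.

(** * Three-term linear recurrences on the integers *)

Definition row_solution (a y : int -> int) : Prop :=
  forall j : int, y (j + 1) + y (j - 1) = a (j + 1) * y j.

Lemma int_step_ind (P : int -> Prop) (j0 : int) : P j0 ->
  (forall j, P j -> P (j + 1)) -> (forall j, P j -> P (j - 1)) ->
  forall j, P j.
Proof.
move=> P0 Pup Pdown.
have up (k : nat) : P (j0 + k%:Z).
  elim: k => [|k IH]; first by rewrite addr0.
  by have -> : j0 + k.+1%:Z = j0 + k%:Z + 1 by [lia]; apply: Pup.
have down (k : nat) : P (j0 - k%:Z).
  elim: k => [|k IH]; first by rewrite subr0.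
  by have -> : j0 - k.+1%:Z = j0 - k%:Z - 1 by [lia]; apply: Pdown.
move=> j; have [le|lt] := leP j0 j.
  by have -> : j = j0 + (absz (j - j0)%R)%:Z by [lia].
by have -> : j = j0 - (absz (j0 - j)%R)%:Z by [lia].
Qed.

Lemma int_period_ind (P : int -> Prop) (m : nat) (j0 : int) : (0 < m)%N ->
  (forall j, P j <-> P (j + m%:Z)) ->
  (forall r, 0 <= r < m%:Z -> P (j0 + r)) -> forall j, P j.
Proof.
move=> m0 shift base j.
have shifts q i : P i -> P (i + q * m%:Z).
  move=> Pi; move: q; apply: (@int_step_ind _ 0) => [|q IH|q IH].
  - by rewrite mul0r addr0.
  - have -> : i + (q + 1) * m%:Z = i + q * m%:Z + m%:Z by ring.
    exact: (shift _).1.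
  - apply: (shift _).2.
    by have -> : i + (q - 1) * m%:Z + m%:Z = i + q * m%:Z by ring.
have -> : j = j0 + ((j - j0) %% m%:Z)%Z + ((j - j0) %/ m%:Z)%Z * m%:Z.
  by have := divz_eq (j - j0) m%:Z; lia.
apply/shifts/base; rewrite modz_ge0 ?ltz_pmod //; lia.
Qed.

Section RowSolutions.
Variable a : int -> int.
Implicit Types y z : int -> int.

Lemma row_solution_comb y z (c d : int) :
  row_solution a y -> row_solution a z ->
  row_solution a (fun j => c * y j + d * z j).
Proof.
move=> sy sz j.
have -> : a (j + 1) * (c * y j + d * z j)
  = c * (a (j + 1) * y j) + d * (a (j + 1) * z j) by ring.
by rewrite -sy -sz; ring.
Qed.

Lemma row_solution_shift y (k : int) : (forall j, a (j + k) = a j) ->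
  row_solution a y -> row_solution a (fun j => y (j + k)).
Proof.
move=> ak sy j; have := sy (j + k).
have -> : j + k + 1 = j + 1 + k by ring.
by have -> : j + k - 1 = j - 1 + k by [ring]; rewrite ak.
Qed.

Lemma row_solution_eq y z (j0 : int) : row_solution a y -> row_solution a z ->
  y j0 = z j0 -> y (j0 + 1) = z (j0 + 1) -> y =1 z.
Proof.
move=> sy sz e0 e1 j.
suff [] : y j = z j /\ y (j + 1) = z (j + 1) by [].
move: j; apply: (@int_step_ind _ j0) => [//|j [ej ej1]|j [ej ej1]].
  split=> //; have := sy (j + 1); have := sz (j + 1).
  by rewrite addrK ej ej1 => <-; lia.
rewrite subrK; split=> //.
by have := sy j; have := sz j; rewrite ej ej1 => <-; lia.
Qed.

(** The transfer matrix of the recurrence has determinant 1, so the discrete Wronskian does not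
    change from one index to the next. *)
Lemma row_wronskian y z (i j : int) : row_solution a y -> row_solution a z ->
  y j * z (j + 1) - z j * y (j + 1) = y i * z (i + 1) - z i * y (i + 1).
Proof.
move=> sy sz.
have step k : y k * z (k + 1) - z k * y (k + 1)
    = y (k - 1) * z k - z (k - 1) * y k.
  have -> : y (k + 1) = a (k + 1) * y k - y (k - 1) by rewrite -sy; ring.
  have -> : z (k + 1) = a (k + 1) * z k - z (k - 1) by rewrite -sz; ring.
  ring.
move: j; apply: (@int_step_ind _ i) => [//|j IH|j IH].
  by rewrite step addrK.
by rewrite subrK -step.
Qed.

Section Basis.
(** The normalisation is that of rows 1 and 2 of the lattice at columns -1 and 0. *)
Variables f g : int -> int.
Hypotheses (sf : row_solution a f) (sg : row_solution a g).
Hypotheses (fN1 : f (-1) = 0) (f0 : f 0 = 1) (gN1 : g (-1) = -1) (g0 : g 0 = 0).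

Lemma row_solution_basis y : row_solution a y ->
  forall j, y j = y 0 * f j - y (-1) * g j.
Proof.
move=> sy j; rewrite -mulNr.
apply: (row_solution_eq (j0 := -1) sy (row_solution_comb _ _ sf sg)).
  by rewrite fN1 gN1; ring.
by rewrite addNr f0 g0; ring.
Qed.

Lemma basis_wronskian (j : int) : f j * g (j + 1) - g j * f (j + 1) = 1.
Proof. by rewrite (row_wronskian (-1) _ sf sg) addNr fN1 f0 gN1 g0; ring. Qed.

(* Cayley-Hamilton for the monodromy matrix over one period, which has
   determinant 1. *)
Lemma row_solution_step (p : int) y : (forall j, a (j + p) = a j) ->
  row_solution a y ->
  forall j, y (j + p + p) = (f p - g (p - 1)) * y (j + p) - y j.
Proof.
move=> ap sy.
have sy1 := row_solution_shift ap sy; have sy2 := row_solution_shift ap sy1.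
have W := basis_wronskian (p - 1); rewrite subrK in W.
have B := row_solution_basis sy.
have B1 := row_solution_basis sy1.
have E1 : y (p + p) = y p * f p - y (p - 1) * g p.
  by rewrite B1 add0r [-1 + p]addrC.
have E2 : y (p - 1 + p) = y p * f (p - 1) - y (p - 1) * g (p - 1).
  by rewrite B1 add0r [-1 + p]addrC.
move=> j; rewrite -[- y j]mulN1r.
(* Both sides solve the recurrence, so agreement at -1 and 0 is enough. In each check the
   coefficient of the last term is replaced by the determinant [W]. *)
apply: (row_solution_eq (j0 := -1) sy2 (row_solution_comb _ _ sy1 sy)).
  rewrite [-1 + p]addrC E2 (B p) (B (p - 1)).
  have -> : -1 * y (-1) = - (f (p - 1) * g p - g (p - 1) * f p) * y (-1).
    by rewrite W.
  ring.
rewrite addNr !add0r E1 (B p) (B (p - 1)).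
have -> : -1 * y 0 = - (f (p - 1) * g p - g (p - 1) * f p) * y 0 by rewrite W.
ring.
Qed.

End Basis.
End RowSolutions.

(** * The lattice of a frieze *)

Section LatticeRows.
Variables (n : nat) (F : frieze n).
Local Notation L := (lattice F).
Local Notation quiddity := (fun j : int => F j j).

Lemma quiddity_periodic (j : int) : F (j + n%:Z) (j + n%:Z) = F j j.
Proof.
by apply: frieze_periodic; have := order_ge3 F; rewrite /in_strip; lia.
Qed.

(** The negated translate by n columns satisfies both mirror conditions, and on the strip it agrees
    with [F] by the glide symmetry; uniqueness of the lattice identifies it with [L]. *)
Lemma lattice_antiperiodic (i j : int) : L i (j + n%:Z) = - L i j.
Proof.
have HL := lattice_is_lattice F.
suff N : is_lattice F (fun i j => - L i (j + n%:Z)).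
  by rewrite -(is_lattice_unique i j N) opprK.
split=> [{}i {}j Hij|{}i {}j|{}i {}j].
- rewrite (lattice_mirrorr HL) opprK.
  have -> : j + n%:Z - n%:Z + 2 = j + 2 by ring.
  rewrite (lattice_strip HL) -?frieze_glide //.
  by move: Hij; rewrite /in_strip; lia.
- rewrite (lattice_mirrorr HL).
  have -> : j + n%:Z - n%:Z + 2 = j + 2 by ring.
  by have -> : i - 2 + n%:Z = i + n%:Z - 2 by ring.
- rewrite (lattice_mirrorl HL) -(is_lattice_shift HL 2) !opprK.
  have -> : j + n%:Z + 2 - 2 * n%:Z = j - n%:Z + 2 by ring.
  by have -> : i - 2 + 2 * n%:Z = i + n%:Z - 2 + n%:Z by ring.
Qed.

Lemma lattice_antisym (i j : int) : L (i + 2) j = - L (j + 2) i.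
Proof. by rewrite (lattice_mirrorl (lattice_is_lattice F)) addrK. Qed.

Lemma lattice_base (i : int) : L i (i - 2) = 0 /\ L i (i - 1) = 1.
Proof.
have n3 := order_ge3 F.
by split; rewrite (lattice_strip (lattice_is_lattice F)) ?entry_zerol
  ?entry_onel // /in_strip; lia.
Qed.

Lemma lattice_gt0 (i j : int) : -1 <= j - i <= n%:Z - 3 -> 0 < L i j.
Proof.
move=> Hij; rewrite (lattice_strip (lattice_is_lattice F)) ?entry_gt0 //.
by move: Hij; rewrite /in_strip; lia.
Qed.

(** Antiperiodicity reduces the claim to the n columns from i - 2 on. All but the first are covered
    by [frieze_row_rec]; at column i - 2 the left neighbour is -1, the antiperiodic image of the
    boundary entry 1 at column i + n - 3. *)
Lemma lattice_row (i : int) : row_solution quiddity (L i).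
Proof.
have n3 := order_ge3 F; have HL := lattice_is_lattice F.
apply: (@int_period_ind _ n (i - 2)) => [|j|r Hr]; first by lia.
  have -> : j + n%:Z + 1 = j + 1 + n%:Z by ring.
  have -> : j + n%:Z - 1 = j - 1 + n%:Z by ring.
  rewrite quiddity_periodic !lattice_antiperiodic mulrN.
  by split => H; lia.
set j := i - 2 + r; have [r0|r0] := eqVneq r 0.
  have -> : j = i - 2 by rewrite /j r0 addr0.
  have -> : i - 2 + 1 = i - 1 by ring.
  rewrite !(lattice_base i).1 (lattice_base i).2 mulr0.
  have := lattice_antiperiodic i (i - 2 - 1).
  rewrite (lattice_strip HL); last by rewrite /in_strip; lia.
  have -> : i - 2 - 1 + n%:Z = i + n%:Z - 3 by ring.
  by rewrite entry_oner; lia.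
by rewrite !(lattice_strip HL) ?frieze_row_rec //; rewrite /in_strip /j; lia.
Qed.

Lemma lattice_basis :
  [/\ L 1 (-1) = 0, L 1 0 = 1, L 2 (-1) = -1 & L 2 0 = 0].
Proof.
have [b0 b1] := lattice_base 2.
have a0 : L 1 (-1) = 0 by have [] := lattice_base 1.
have a1 : L 1 0 = 1 by have [] := lattice_base 1.
(* Column -1 of row 2 lies just outside the strip, so its value is read off the recurrence at column
   0. *)
have := lattice_row 2 0; rewrite add0r sub0r.
have -> : L 2 1 = 1 by exact: b1.
have -> : L 2 0 = 0 by exact: b0.
by rewrite mulr0 => /eqP; rewrite addrC addr_eq0 => /eqP H; split.
Qed.

(** Every entry is a 2 by 2 minor of the matrix formed by rows 1 and 2. As functions of j both sides
    solve the recurrence; they vanish at j = i, and at j = i + 1 the minor is the Wronskian 1. *)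
Lemma lattice_plucker (i j : int) :
  L (i + 2) j = L 1 i * L 2 j - L 2 i * L 1 j.
Proof.
have [fN1 f0 gN1 g0] := lattice_basis.
have [b0 b1] := lattice_base (i + 2).
rewrite addrK in b0; have e : i + 2 - 1 = i + 1 by [ring]; rewrite e in b1.
rewrite -mulNr.
apply: (row_solution_eq (j0 := i) (lattice_row _)
  (row_solution_comb _ _ (lattice_row 2) (lattice_row 1))).
  by rewrite b0; ring.
rewrite b1 mulNr (basis_wronskian (lattice_row 1) (lattice_row 2)) //.
Qed.

(** This is the Plücker relation between 2 by 2 minors; [L (x + 2) y] plays the role of the length
    of the segment from x to y. *)
Lemma lattice_ptolemy (i j k l : int) :
  L (i + 2) k * L (j + 2) l
  = L (i + 2) j * L (k + 2) l + L (i + 2) l * L (j + 2) k.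
Proof. rewrite !lattice_plucker; ring. Qed.

(** Row i + k, translated by k, solves the same recurrence as row i with the same two initial values
    0 and 1. *)
Lemma lattice_period (k : nat) :
  (forall j : int, F (j + k%:Z) (j + k%:Z) = F j j) ->
  forall i j : int, L (i + k%:Z) (j + k%:Z) = L i j.
Proof.
move=> ak i; apply: (row_solution_eq (j0 := i - 2)
  (row_solution_shift ak (lattice_row _)) (lattice_row i)).
  have [e _] := lattice_base (i + k%:Z); rewrite (lattice_base i).1.
  by have -> // : i - 2 + k%:Z = i + k%:Z - 2 by ring.
have e : i - 2 + 1 = i - 1 by ring.
have [_ e1] := lattice_base (i + k%:Z); rewrite e (lattice_base i).2.
by have -> // : i - 1 + k%:Z = i + k%:Z - 1 by ring.
Qed.

(** * Periods of the frieze *)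

Lemma frieze_period_quiddity (k : nat) : frieze_period F k ->
  forall j : int, F (j + k%:Z) (j + k%:Z) = F j j.
Proof.
by move=> Fk j; apply: Fk; have := order_ge3 F; rewrite /in_strip; lia.
Qed.

Lemma frieze_period_quiddityP (k : nat) :
  frieze_period F k <-> forall j : int, F (j + k%:Z) (j + k%:Z) = F j j.
Proof.
split=> [|ak i j Hij]; first exact: frieze_period_quiddity.
rewrite -!(lattice_strip (lattice_is_lattice F)) ?lattice_period //.
by move: Hij; rewrite /in_strip; lia.
Qed.

Lemma min_periodP : [/\ (0 < min_period F)%N, frieze_period F (min_period F) &
  forall k, (0 < k)%N -> frieze_period F k -> (min_period F <= k)%N].
Proof.
rewrite /min_period; case: ex_minnP => p /andP[p0 /asboolP Fp] pmin.
by split=> // k k0 Fk; apply: pmin; rewrite k0; apply/asboolP.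
Qed.

Lemma min_period_dvd (k : nat) : frieze_period F k -> (min_period F %| k)%N.
Proof.
have [p0 Fp pmin] := min_periodP => /frieze_period_quiddityP Fk.
move: (min_period F) p0 Fp pmin => p p0 /frieze_period_quiddityP Fp pmin.
have Fq (q : nat) (j : int) : F (j + (q * p)%N%:Z) (j + (q * p)%N%:Z) = F j j.
  elim: q => [|q IH]; first by rewrite mul0n addr0.
  by rewrite mulSn addnC PoszD addrA Fp.
have Fr : frieze_period F (k %% p).
  apply/frieze_period_quiddityP => j; rewrite -(Fq (k %/ p)%N).
  have -> : j + (k %% p)%N%:Z + (k %/ p * p)%N%:Z = j + k%:Z.
    by rewrite {3}(divn_eq k p); lia.
  exact: Fk.
rewrite /dvdn; case: posnP => // r0.
by have := pmin _ r0 Fr; rewrite leqNgt ltn_pmod.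
Qed.

(** * The growth sequence and the order of symmetry *)

Local Notation p := (min_period F).

(** The formula also covers k = 0, where it gives 1 - (-1) = 2, the trace of the identity. *)
Lemma growth_sequenceE (k : nat) :
  growth_sequence F k = L 1 (k%:Z * p%:Z) - L 2 (k%:Z * p%:Z - 1).
Proof.
case: k => [|k] //=; rewrite mul0r sub0r.
by have [_ -> -> _] := lattice_basis.
Qed.

Lemma lattice_step (i j : int) :
  L i (j + p%:Z + p%:Z) = growth_sequence F 1 * L i (j + p%:Z) - L i j.
Proof.
have [fN1 f0 gN1 g0] := lattice_basis; have [_ Fp _] := min_periodP.
rewrite growth_sequenceE mul1r.
exact: (row_solution_step (lattice_row 1) (lattice_row 2) _ _ _ _
  (frieze_period_quiddity Fp) (lattice_row i)).
Qed.

Lemma growth_sequence_rec (k : nat) : growth_sequence F k.+2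
  = growth_sequence F 1 * growth_sequence F k.+1 - growth_sequence F k.
Proof.
have e (m : nat) (x : int) : m.+1%:Z * p%:Z + x = m%:Z * p%:Z + x + p%:Z.
  by rewrite intS; ring.
have e0 (m : nat) : m.+1%:Z * p%:Z = m%:Z * p%:Z + p%:Z.
  by rewrite intS; ring.
rewrite [in LHS]growth_sequenceE [growth_sequence F k.+1]growth_sequenceE.
rewrite [growth_sequence F k]growth_sequenceE !e !e0 !lattice_step; ring.
Qed.

Lemma growth_sequence_unique (s : nat -> int) :
  s 0%N = 2 -> s 1%N = growth_sequence F 1 ->
  (forall k, s k.+2 = s 1%N * s k.+1 - s k) -> growth_sequence F =1 s.
Proof.
move=> s0 s1 srec k.
suff [] : growth_sequence F k = s k /\ growth_sequence F k.+1 = s k.+1 by [].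
elim: k => [|k [IH IH1]]; first by rewrite s0 s1.
by split; rewrite // growth_sequence_rec srec IH IH1 s1.
Qed.

Lemma frieze_symmetry_order :
  [\/ n = p /\ growth_sequence F 1 = -2,
      n = (2 * p)%N /\ growth_sequence F 1 = 0 |
      n = (3 * p)%N /\ growth_sequence F 1 = 1].
Proof.
have n3 := order_ge3 F; have [p0 Fp _] := min_periodP.
have [fN1 f0 gN1 g0] := lattice_basis.
have /dvdnP[d nE] := min_period_dvd (@frieze_periodic n F).
set t := growth_sequence F 1.
pose x (k : nat) := L 1 (k%:Z * p%:Z - 1).
have xrec k : x k.+2 = t * x k.+1 - x k.
  have e (m : nat) : m.+1%:Z * p%:Z - 1 = m%:Z * p%:Z - 1 + p%:Z.
    by rewrite intS; ring.
  by rewrite /x !e lattice_step.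
have x0 : x 0%N = 0 by rewrite /x mul0r sub0r.
have xd : x d = 0.
  rewrite /x -PoszM -nE addrC lattice_antiperiodic fN1 oppr0 //.
have xpos k : (0 < k < d)%N -> 0 < x k.
  move=> /andP[k0 kd]; apply: lattice_gt0; rewrite -PoszM.
  have : (p <= k * p)%N by rewrite leq_pmull.
  have : (k.+1 * p <= n)%N.
    by apply: leq_trans (_ : d * p <= n)%N; rewrite ?leq_pmul2r // -nE.
  by rewrite mulSn; lia.
(* Since x 0 = 0, the recurrence gives x 2 = t * x 1: thus d = 2 forces t = 0, and d >= 3 forces t >
   0. For d = 1 the trace comes directly from antiperiodicity, as - L 1 0 + L 2 (-1) = -2. *)
case: d => [|[|[|d]]] in nE xd xpos *.
- lia.
- constructor 1; rewrite mul1n in nE; split=> //.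
  rewrite /t growth_sequenceE mul1r -nE -[n%:Z]add0r lattice_antiperiodic.
  have -> : 0 + n%:Z - 1 = -1 + n%:Z by ring.
  by rewrite lattice_antiperiodic f0 gN1.
- constructor 2; split=> //; have x1 := xpos 1%N isT.
  have := xrec 0%N; rewrite xd x0 subr0 => /esym/eqP.
  by rewrite mulf_eq0 (gt_eqF x1) orbF => /eqP.
have x1 := xpos 1%N isT; have x2 := xpos 2%N isT.
have t0 : 0 < t.
  by move: x2; rewrite xrec x0 subr0 pmulr_lgt0.
(* If t = 1, then x 3 = x 2 - x 1 = 0, which leaves only d = 3. If t >= 2, then x increases strictly
   from 0 and cannot vanish at d. *)
have [t1|t1] := ltP 1 t; last first.
  have tE : t = 1 by lia.
  constructor 3; split=> //; case: d => [|d] // in nE xd xpos *.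
  have := xpos 3%N isT; rewrite !xrec tE x0; lia.
have incr k : 0 <= x k < x k.+1.
  elim: k => [|k /andP[IH1 IH2]]; first by rewrite x0 lexx.
  rewrite xrec; have : 2 * x k.+1 <= t * x k.+1.
    by rewrite ler_pM2r ?(le_lt_trans IH1) //; lia.
  lia.
by have := incr d.+2; rewrite xd => /andP[H1 H2]; have := le_lt_trans H1 H2.
Qed.

End LatticeRows.

(** * Triangulations *)

Section Chords.
Variable n : nat.
Implicit Types (u v w x y z : 'I_n) (e : {set 'I_n}).
Local Open Scope nat_scope.

Lemma set2_inj_lt u v x y : u < v -> x < y ->
  [set u; v] = [set x; y] -> u = x /\ v = y.
Proof.
move=> uv xy E.
have ux : u \in [set x; y] by rewrite -E set21.
have vx : v \in [set x; y] by rewrite -E set22.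
have xu : x \in [set u; v] by rewrite E set21.
have yu : y \in [set u; v] by rewrite E set22.
move: ux vx xu yu; rewrite !inE -!val_eqE /= => ux vx xu yu.
by split; apply: val_inj => /=; lia.
Qed.

Lemma set2_lt e : #|e| = 2 -> exists u v, u < v /\ e = [set u; v].
Proof.
move=> /eqP/cards2P[u [v [uv ->]]].
have [lt|lt|/val_inj E] := ltngtP u v; last by rewrite E eqxx in uv.
- by exists u, v.
- by exists v, u; rewrite setUC.
Qed.

Lemma polygon_side_lt u v : u < v ->
  polygon_side [set u; v] =
  (v == u.+1 :> nat) || (u == 0 :> nat) && (v == n.-1 :> nat).
Proof.
move=> uv; have vn := ltn_ord v.
apply/existsP/idP => [[x /eqP E]|].
  have [xn|xn] := ltnP x.+1 n.
    have sx : ordS x = x.+1 :> nat by rewrite /= modn_small.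
    have xs : x < ordS x by rewrite sx.
    have [-> ->] := set2_inj_lt uv xs E; rewrite sx //.
    by rewrite eqxx.
  have xE : x = n.-1 :> nat by have := ltn_ord x; rewrite /=; lia.
  have sx : ordS x = 0 :> nat by rewrite /= xE prednK ?modnn; lia.
  have x0 : ordS x < x.
    rewrite sx xE -ltnS prednK; lia.
  have [-> ->] := set2_inj_lt uv x0 (etrans E (setUC _ _)).
  by rewrite sx xE !eqxx orbT.
case/orP => [/eqP vE|/andP[/eqP u0 /eqP vE]].
  exists u; apply/eqP; congr [set _; _]; apply: val_inj.
  by rewrite /= modn_small -vE.
exists v; rewrite setUC; apply/eqP; congr [set _; _]; apply: val_inj.
by rewrite /= vE prednK ?modnn //; lia.
Qed.

Lemma crossingP e f : reflect
  (exists a b c d : 'I_n, [/\ a < b, b < c, c < d &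
     e = [set a; c] /\ f = [set b; d] \/ e = [set b; d] /\ f = [set a; c]])
  (crossing e f).
Proof.
apply: (iffP existsP) => [[a]|[a [b [c [d [ab bc cd H]]]]]]; last first.
  exists a; apply/existsP; exists b; apply/existsP; exists c; apply/existsP.
  exists d; rewrite ab bc cd /=.
  by case: H => [] [-> ->]; rewrite !eqxx ?orbT.
case/existsP=> b /existsP[c /existsP[d /and4P[ab bc cd H]]].
exists a, b, c, d; split=> //.
by case/orP: H => /andP[/eqP-> /eqP->]; [left | right].
Qed.

Lemma crossingC e f : crossing e f = crossing f e.
Proof.
by apply/crossingP/crossingP => [] [a [b [c [d [ab bc cd H]]]]];
  exists a, b, c, d; split=> //; case: H => [] [-> ->]; auto.
Qed.

Lemma crossing_irr e : ~~ crossing e e.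
Proof.
apply/negP => /crossingP[a [b [c [d [ab bc cd H]]]]].
have ac := ltn_trans ab bc; have bd := ltn_trans bc cd.
have E : [set a; c] = [set b; d] by case: H => [] [<- <-].
by have [E1 _] := set2_inj_lt ac bd E; move: ab; rewrite E1 ltnn.
Qed.

End Chords.

(** * Chords of a triangulation *)

Section Triangulation.
Variables (n : nat) (T : {set {set 'I_n}}).
Hypothesis trT : triangulation T.
Implicit Types (u v w x y z : 'I_n) (e t : {set 'I_n}).
Local Open Scope nat_scope.

(** Sides and diagonals are treated alike, since both bound triangles and both have lattice entry
    1. *)
Definition chord (x y : 'I_n) : bool :=
  polygon_side [set x; y] || ([set x; y] \in T).

Lemma chordC x y : chord x y = chord y x.
Proof. by rewrite /chord setUC. Qed.

Lemma triangulation_diagonal e : e \in T -> diagonal e.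
Proof.
by case/maxsetP: trT => /andP[/forallP H _] _ eT; have := H e; rewrite eT.
Qed.

Lemma triangulation_noncrossing e f : e \in T -> f \in T -> ~~ crossing e f.
Proof.
case/maxsetP: trT => /andP[_ /forall_inP H] _ eT fT.
by have /forall_inP := H e eT; apply.
Qed.

(** Diagonals of [T] do not cross each other, and a side crosses nothing because one of its two arcs
    contains no further vertex. *)
Lemma chord_noncrossing x y z w : x < y -> y < z -> z < w ->
  chord x z -> chord y w -> False.
Proof.
move=> xy yz zw; have xz := ltn_trans xy yz; have yw := ltn_trans yz zw.
have wn := ltn_ord w.
rewrite /chord !polygon_side_lt // => /orP[|xzT]; first by lia.
case/orP=> [|ywT]; first by lia.
have /negP := triangulation_noncrossing xzT ywT; apply.
by apply/crossingP; exists x, y, z, w; split=> //; left.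
Qed.

(** Otherwise the segment could be added to [T], against maximality. *)
Lemma not_chord_crossed u v : u < v -> ~~ chord u v ->
  exists2 e, e \in T & crossing [set u; v] e.
Proof.
move=> uv; rewrite /chord negb_or => /andP[nside nT].
apply: contrapT => H; move/negP: nT; apply.
case/maxsetP: trT => _ maxT.
rewrite -(maxT ([set u; v] |: T)) ?setU11 ?subsetU1 //.
have nuv : u != v by apply/eqP => E; rewrite E ltnn in uv.
have ncr e : e \in T -> ~~ crossing [set u; v] e.
  by move=> eT; apply/negP => cr; apply: H; exists e.
apply/andP; split.
  apply/forall_inP => e /setU1P[->|/triangulation_diagonal //].
  by rewrite /diagonal cards2 nuv.
apply/forall_inP => e /setU1P[->|eT]; apply/forall_inP => f /setU1P[->|fT].
- exact: crossing_irr.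
- exact: ncr.
- by rewrite crossingC ncr.
- exact: triangulation_noncrossing.
Qed.

(** The apex is the largest vertex w below v that is joined to u; the vertex u + 1 is a candidate. A
    diagonal crossing the segment from w to v would cross one of the chords uv and uw, or would
    start at u and end beyond w, against the choice of w. *)
Lemma chord_apex u v : u.+1 < v -> chord u v ->
  exists w, [/\ u < w, w < v, chord u w & chord w v].
Proof.
move=> uv cuv; have un : u.+1 < n by exact: ltn_trans (ltn_ord v).
have u1 : (u < Ordinal un < v) && chord u (Ordinal un).
  by rewrite /= ltnSn uv /chord polygon_side_lt //= eqxx.
case: (@arg_maxnP _ (Ordinal un) (fun w => (u < w < v) && chord u w) val u1).
move=> w /andP[/andP[uw wv] cuw] wmax; exists w; split=> //.
apply: contraT => /(not_chord_crossed wv)[f fT /crossingP].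
move=> [a [b [c [d [ab bc cd [] [E1 E2]]]]]].
  have [? ?] := set2_inj_lt wv (ltn_trans ab bc) E1; subst a c.
  case: (@chord_noncrossing u b v d) => //; first exact: ltn_trans ab.
  by rewrite /chord -E2 fT orbT.
have [? ?] := set2_inj_lt wv (ltn_trans bc cd) E1; subst b d.
have cac : chord a c by rewrite /chord -E2 fT orbT.
have [lt|lt|/val_inj E] := ltngtP a u.
- by case: (@chord_noncrossing a u c v) => //; lia.
- by case: (@chord_noncrossing u a w c).
subst a; have := wmax c; rewrite cac cd (ltn_trans ab bc) => /(_ isT) /=; lia.
Qed.

Lemma trianglesP t x y : t \in triangles T -> x \in t -> y \in t -> x != y ->
  chord x y.
Proof.
rewrite in_set => /andP[_ /forall_inP H] xt yt xy.
by have /forall_inP/(_ y yt)/implyP := H x xt; apply.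
Qed.

(** * Counting the triangles cut off by a chord *)

Definition triangles_between u v : {set {set 'I_n}} :=
  [set t in triangles T | [forall x in t, u <= x <= v]].

Definition triangles_between_at u v x : nat :=
  #|[set t in triangles_between u v | x \in t]|.

Lemma triangles_betweenP u v t : reflect
  (t \in triangles T /\ forall x, x \in t -> u <= x <= v)
  (t \in triangles_between u v).
Proof.
rewrite [t \in triangles_between u v]in_set; apply: (iffP andP).
all: case=> tT H; split=> //.
  by move=> x xt; move/forall_inP: H; apply.
exact/forall_inP.
Qed.

(** A triangle with vertices x < w < z has an edge passing over w. As it crosses neither uw nor wv,
    x = u and z = v; the same two chords then force the third vertex to be w. *)
Lemma triangles_between_split u v w : u < w -> w < v ->
  chord u v -> chord u w -> chord w v ->
  triangles_between u v =
  [set u; w; v] |: (triangles_between u w :|: triangles_between w v).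
Proof.
move=> uw wv cuv cuw cwv; apply/setP => t; rewrite !in_setU in_set1.
have uv := ltn_trans uw wv.
have c3 : #|[set u; w; v]| = 3.
  rewrite setUC cardsU1 cards2 !inE -!val_eqE /=; lia.
apply/idP/idP => [/triangles_betweenP[tT tuv]|].
  case: (boolP [forall x in t, x <= w]) => [/forall_inP tw|].
    apply/orP; right; apply/orP; left; apply/triangles_betweenP.
    split=> // x xt.
    by rewrite tw //; have /andP[-> _] := tuv x xt.
  rewrite negb_forall_in => /exists_inP[z zt]; rewrite -ltnNge => wz.
  case: (boolP [forall x in t, w <= x]) => [/forall_inP tw|].
    apply/orP; right; apply/orP; right; apply/triangles_betweenP.
    split=> // x xt.
    by rewrite tw //; have /andP[_ ->] := tuv x xt.
  rewrite negb_forall_in => /exists_inP[x xt]; rewrite -ltnNge => xw.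
  have /andP[ux _] := tuv x xt; have /andP[_ zv] := tuv z zt.
  have cxz : chord x z.
    by apply: (trianglesP tT) => //; rewrite -val_eqE /=; lia.
  have xE : x = u.
    apply: val_inj; apply/eqP => /=; rewrite eqn_leq ux andbT leqNgt.
    by apply/negP => lt; case: (@chord_noncrossing u x w z).
  subst x.
  have zE : z = v.
    apply: val_inj; apply/eqP => /=; rewrite eqn_leq zv /= leqNgt.
    by apply/negP => lt; case: (@chord_noncrossing u w z v).
  subst z; apply/orP; left; rewrite eqEcard c3.
  have -> : #|t| = 3 by move: tT; rewrite in_set => /andP[/eqP->].
  rewrite andbT; apply/subsetP => y yt; rewrite !inE.
  have /andP[uy yv] := tuv y yt.
  have [//|yu] := eqVneq y u; have [|yv'] := eqVneq y v; first by rewrite orbT.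
  have cuy : chord u y by apply: (trianglesP tT) => //; rewrite eq_sym.
  have cyv : chord y v by apply: (trianglesP tT).
  move: yu yv'; rewrite -!val_eqE /= => yu yv'.
  have [lt|lt|//] := ltngtP y w.
  - by case: (@chord_noncrossing u y w v) => //; lia.
  - by case: (@chord_noncrossing u w y v) => //; lia.
case/orP=> [/eqP->|/orP[]/triangles_betweenP[tT H]]; apply/triangles_betweenP.
- split=> [|x]; last by rewrite !inE => /orP[/orP[]|] /eqP->; lia.
  rewrite inE c3 eqxx /=; apply/forall_inP => x xt; apply/forall_inP => y yt.
  apply/implyP; rewrite -/(chord x y); move: xt yt; rewrite !inE.
  by move=> /orP[/orP[]|] /eqP-> /orP[/orP[]|] /eqP->;
    rewrite ?eqxx // => _; rewrite // chordC.
- by split=> // x /H; lia.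
- by split=> // x /H; lia.
Qed.

Lemma triangles_between_at_split u v w x : u < w -> w < v ->
  chord u v -> chord u w -> chord w v ->
  triangles_between_at u v x =
  (x \in [set u; w; v]) +
  (triangles_between_at u w x + triangles_between_at w v x).
Proof.
move=> uw wv cuv cuw cwv; have uv := ltn_trans uw wv.
rewrite /triangles_between_at (triangles_between_split uw wv) //.
have cardU (A B : {set {set 'I_n}}) :
    (forall t, t \in A -> t \in B -> False) -> #|A :|: B| = #|A| + #|B|.
  move=> AB; rewrite cardsU (_ : A :&: B = set0) ?cards0 ?subn0 //.
  by apply/setP => t; rewrite in_set0; apply/negP => /setIP[/AB].
have setE (A : {set {set 'I_n}}) :
    [set t in A | x \in t] = A :&: [set t : {set 'I_n} | x \in t].
  exact: setIdE.
rewrite !setE setIUl setIUl !cardU.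
- congr addn; have [xA|xA] := boolP (x \in [set u; w; v]).
    by rewrite (setIidPl _) ?cards1 // sub1set in_set.
  rewrite (_ : _ :&: _ = set0) ?cards0 //.
  apply/setP => t; rewrite in_set0; apply/negP => /setIP[/set1P->].
  by rewrite in_set (negbTE xA).
(* A triangle on both sides of w would have w as its only vertex. *)
- move=> t /setIP[/triangles_betweenP[tT H] _].
  move=> /setIP[/triangles_betweenP[_ H'] _].
  have : t \subset [set w].
    apply/subsetP => y yt; rewrite in_set1 -val_eqE /=.
    by have := H y yt; have := H' y yt; lia.
  move/subset_leq_card; rewrite cards1.
  by move: tT; rewrite in_set => /andP[/eqP-> _].
- move=> t /setIP[/set1P-> _] /setUP[] /setIP[/triangles_betweenP[_ H] _].
    by have := H v; rewrite !inE eqxx orbT => /(_ isT); lia.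
  by have := H u; rewrite !inE eqxx => /(_ isT); lia.
Qed.

(** An edge from x to a vertex outside the range from u to v would cross the chord uv. *)
Lemma triangles_at_between u v x : u < x -> x < v -> chord u v ->
  triangles_at T x = triangles_between_at u v x.
Proof.
move=> ux xv cuv; apply: eq_card => t; apply/setIdP/setIdP; last first.
  by case=> /triangles_betweenP[].
case=> tT xt; split=> //.
apply/triangles_betweenP; split=> // y yt.
have [->|xy] := eqVneq y x; first by rewrite (ltnW ux) ltnW.
have cyx : chord y x by apply: (trianglesP tT).
rewrite leqNgt [y <= v]leqNgt; apply/andP; split; apply/negP => lt.
  by case: (@chord_noncrossing y u x v).
by rewrite chordC in cyx; case: (@chord_noncrossing u x v y).
Qed.

Lemma triangles_between_at0 u v x : x < u \/ v < x \/ v = u.+1 :> nat ->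
  triangles_between_at u v x = 0.
Proof.
move=> H; apply: eq_card0 => t; apply/negP => /setIdP[].
move=> /triangles_betweenP[tT tuv] xt; case: H => [|[]] H.
- by have := tuv x xt; lia.
- by have := tuv x xt; lia.
have : t \subset [set u; v].
  apply/subsetP => y yt; have := tuv y yt; rewrite !inE -!val_eqE /=; lia.
move/subset_leq_card; rewrite cards2.
move: tT; rewrite in_set => /andP[/eqP-> _]; by case: (_ != _).
Qed.

(* A solution of the recurrence at the vertices strictly between [u] and [v]
   closes up antiperiodically around the subpolygon cut off by [u] and [v]. *)
Lemma chord_closing (y : int -> int) u v :
  (forall j : 'I_n, (u < j < v)%N ->
    y (j%:Z + 1) + y (j%:Z - 1) = (triangles_at T j)%:Z * y j)%R ->
  u < v -> chord u v ->
  ((triangles_between_at u v u)%:Z * y u = y (u%:Z + 1) - y v /\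
  (triangles_between_at u v v)%:Z * y v = y (v%:Z - 1) - y u)%R.
Proof.
have [m] := ubnP (v - u); elim: m u v => // m IH u v muv yuv uv cuv.
have [vE|uv1] := leqP v u.+1.
  have vE' : v = u.+1 :> nat by lia.
  rewrite !triangles_between_at0; try by auto.
  by rewrite vE' -addn1 PoszD addrK !mul0r !subrr.
have [w [uw wv cuw cwv]] := chord_apex uv1 cuv.
have [Lu Lw] : _ /\ _ := IH u w ltac:(lia) (fun j H => yuv j ltac:(lia)) uw cuw.
have [Rw Rv] : _ /\ _ := IH w v ltac:(lia) (fun j H => yuv j ltac:(lia)) wv cwv.
(* The recurrence at w, with the triangle count there split as 1 plus the counts on the two sides,
   yields y w = y u + y v; this turns the relations for uw and wv into those for uv. *)
have := yuv w ltac:(lia); rewrite (triangles_at_between uw wv cuv).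
rewrite !(triangles_between_at_split _ uw wv) // !inE !eqxx !orbT /=.
rewrite [triangles_between_at w v u]triangles_between_at0; last by auto.
rewrite [triangles_between_at u w v]triangles_between_at0; last by auto.
rewrite !PoszD !mulrDl Lu Lw Rw Rv.
by split; lia.
Qed.

End Triangulation.

(** * Rotations *)

Section Rotation.
Variables (n k : nat).
Local Notation rot := (iter k (@ordS n)).

Lemma iter_ordSE (v : 'I_n) : rot v = ((v + k) %% n)%N :> nat.
Proof.
elim: k => [|m IH]; first by rewrite addn0 modn_small.
by rewrite iterS /= IH -addn1 modnDml addn1 addnS.
Qed.

Lemma iter_ordS_inj : injective rot.
Proof. by elim: k => [|m IH] x y //= /(can_inj (@ordSK n)); apply: IH. Qed.

Lemma polygon_side_imset (e : {set 'I_n}) :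
  polygon_side (rot @: e) = polygon_side e.
Proof.
apply/existsP/existsP => [[w /eqP E]|[w /eqP->]]; last first.
  exists (rot w); apply/eqP; rewrite imsetU1 imset_set1.
  by rewrite -iterS -iterSr.
have [g gK rotK] := injF_bij iter_ordS_inj.
exists (g w); apply/eqP; apply: (imset_inj iter_ordS_inj); rewrite E.
by rewrite imsetU1 imset_set1 -iterSr iterS rotK.
Qed.

(** A rotation is injective, so by cardinality one inclusion suffices, and it holds because sides
    and diagonals of [T] are mapped to sides and diagonals of [T]. *)
Lemma triangles_imset (T : {set {set 'I_n}}) : rotate_triangulation k T = T ->
  [set rot @: t | t : {set 'I_n} in triangles T] = triangles T.
Proof.
move=> rT; apply/eqP; rewrite eqEcard card_imset ?leqnn ?andbT; last first.
  exact: imset_inj iter_ordS_inj.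
apply/subsetP => _ /imsetP[t + ->]; rewrite !in_set.
rewrite (card_imset _ iter_ordS_inj) => /andP[-> /forall_inP H] /=.
apply/forall_inP => _ /imsetP[x xt ->]; apply/forall_inP => _ /imsetP[y yt ->].
apply/implyP => xy; have {xy} xy : x != y by apply: contraNneq xy => ->.
have -> : [set rot x; rot y] = rot @: [set x; y].
  by rewrite imsetU1 imset_set1.
have /forall_inP/(_ y yt)/implyP/(_ xy)/orP[side|xyT] := H x xt.
  by rewrite polygon_side_imset side.
apply/orP; right; rewrite -rT; exact: imset_f.
Qed.

Lemma triangles_at_imset (T : {set {set 'I_n}}) (v : 'I_n) :
  rotate_triangulation k T = T -> triangles_at T (rot v) = triangles_at T v.
Proof.
move=> rT; rewrite /triangles_at.
rewrite -(card_imset [set t in triangles T | v \in t]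
  (imset_inj iter_ordS_inj)).
apply: eq_card => t; apply/setIdP/imsetP => [[tT vt]|[s /setIdP[sT vs] ->]].
  move: tT vt; rewrite -{1}(triangles_imset rT) => /imsetP[s sT ->].
  rewrite (mem_imset _ _ iter_ordS_inj) => vs.
  by exists s => //; apply/setIdP.
split; last exact: imset_f.
by rewrite -(triangles_imset rT); apply: imset_f.
Qed.

End Rotation.

(** * The associated triangulation as the set of diagonals with entry 1 *)

Section AssociatedTriangulation.
Variables (n : nat) (F : frieze n) (T : {set {set 'I_n}}).
Hypothesis assoc : associated_triangulation F T.
Local Notation L := (lattice F).

(** Row u + 2 takes the values 0 and 1 at u and u + 1, so its closing relation at u reads 0 = 1 -
    [L (u + 2) v]. *)
Lemma chord_lattice (u v : 'I_n) : (u < v)%N -> chord T u v ->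
  L (u%:Z + 2) v = 1.
Proof.
move=> uv cuv; have [trT aT] := assoc.
have [b0 b1] := lattice_base F (u%:Z + 2); rewrite addrK in b0.
have e : u%:Z + 2 - 1 = u%:Z + 1 by [ring]; rewrite e in b1.
have rec (j : 'I_n) : (u < j < v)%N ->
    L (u%:Z + 2) (j%:Z + 1) + L (u%:Z + 2) (j%:Z - 1)
    = (triangles_at T j)%:Z * L (u%:Z + 2) j.
  (* The element j of ['I_n] is vertex j + 1, which matches the index j + 1 of the coefficient in
     the row recurrence. *)
  by move=> _; rewrite -aT -[j.+1]addn1 PoszD; apply: lattice_row.
have [+ _] := chord_closing trT rec uv cuv.
by rewrite b0 b1 mulr0 => /esym/eqP; rewrite subr_eq0 => /eqP.
Qed.

Lemma normr_latticeC (x y : int) : `|L (x + 2) y| = `|L (y + 2) x|.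
Proof. by rewrite lattice_antisym normrN. Qed.

Lemma normr_lattice_addn (q : nat) (x y : int) :
  `|L (x + 2) (y + (q * n)%N%:Z)| = `|L (x + 2) y|.
Proof.
elim: q => [|q IH]; first by rewrite mul0n addr0.
have -> : y + (q.+1 * n)%N%:Z = y + (q * n)%N%:Z + n%:Z by rewrite mulSn; lia.
by rewrite lattice_antiperiodic normrN.
Qed.

Lemma normr_lattice_modn (x y : nat) :
  `|L ((x %% n)%N%:Z + 2) (y %% n)%N| = `|L (x%:Z + 2) y|.
Proof.
have E (z : nat) : z%:Z = (z %% n)%N%:Z + (z %/ n * n)%N%:Z.
  by rewrite {1}(divn_eq z n) addnC.
rewrite [in RHS](E y) normr_lattice_addn normr_latticeC.
by rewrite [in RHS]normr_latticeC (E x) normr_lattice_addn.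
Qed.

(** The absolute value makes the condition independent of the order of x and y and of
    representatives modulo n, since [L] is antisymmetric and antiperiodic. *)
Definition unit_pair (e : {set 'I_n}) : bool :=
  [exists x : 'I_n, exists y : 'I_n,
     (e == [set x; y]) && (`|L (x%:Z + 2) y| == 1)].

Lemma unit_pair_lt (u v : 'I_n) : (u < v)%N -> unit_pair [set u; v] ->
  L (u%:Z + 2) v = 1.
Proof.
move=> uv /existsP[x /existsP[y /andP[/eqP E /eqP N]]].
have vn := ltn_ord v.
rewrite -[L _ _]gtr0_norm; last by apply: lattice_gt0; lia.
have [lt|lt|/val_inj xy] := ltngtP x y.
- by have [-> ->] := set2_inj_lt uv lt E.
- have [-> ->] := set2_inj_lt uv lt (etrans E (setUC _ _)).
  by rewrite normr_latticeC.
- move: N; rewrite xy; have [b0 _] := lattice_base F (y%:Z + 2).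
  by rewrite addrK in b0; rewrite b0 normr0.
Qed.

Lemma triangulation_unit_pairs : T = [set e | diagonal e && unit_pair e].
Proof.
have [trT aT] := assoc; case/maxsetP: (trT) => _ maxT; symmetry; apply: maxT.
  apply/andP; split; apply/forall_inP => e; first by rewrite in_set => /andP[].
  rewrite in_set => /andP[_ ue]; apply/forall_inP => f.
  rewrite in_set => /andP[_ uf].
  apply/negP => /crossingP[a [b [c [d [ab bc cd H]]]]].
  have dn := ltn_ord d.
  have [uac ubd] : unit_pair [set a; c] /\ unit_pair [set b; d].
    by case: H => [] [E1 E2]; rewrite -E1 -E2.
  have Lac := unit_pair_lt (ltn_trans ab bc) uac.
  have Lbd := unit_pair_lt (ltn_trans bc cd) ubd.
  have pos (x y : nat) : (x < y < n)%N -> 0 < L (x%:Z + 2) y.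
    by move=> xy; apply: lattice_gt0; lia.
  (* For crossing unit diagonals Ptolemy's relation would write 1 as a sum of two positive
     integers. *)
  have := lattice_ptolemy F a b c d; rewrite Lac Lbd.
  have := mulr_gt0 (pos a b ltac:(lia)) (pos c d ltac:(lia)).
  have := mulr_gt0 (pos a d ltac:(lia)) (pos b c ltac:(lia)).
  lia.
apply/subsetP => e eT; have De := triangulation_diagonal trT eT.
rewrite in_set De /=; move: (De) => /andP[/eqP /set2_lt[u [v [uv E]]] _].
apply/existsP; exists u; apply/existsP; exists v; rewrite E eqxx /=.
by rewrite chord_lattice ?normr1 // /chord -E eT orbT.
Qed.

(** The diagonals of [T] are characterised by lattice entries, which are invariant under the
    diagonal translation by k. *)
Lemma frieze_period_rotate (k : nat) : frieze_period F k ->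
  rotate_triangulation k T = T.
Proof.
move=> Fk; have Lk := lattice_period (frieze_period_quiddity Fk).
have rinj := @iter_ordS_inj n k.
apply/eqP; rewrite eqEcard card_imset ?leqnn ?andbT; last exact: imset_inj.
apply/subsetP => _ /imsetP[e eT ->]; move: eT.
rewrite {1 2}triangulation_unit_pairs !in_set /diagonal polygon_side_imset.
rewrite (card_imset _ rinj) => /andP[-> /existsP[x /existsP[y]]].
move=> /andP[/eqP-> /eqP N].
apply/existsP; exists (iter k (@ordS n) x); apply/existsP.
exists (iter k (@ordS n) y); rewrite imsetU1 imset_set1 eqxx /=.
rewrite !iter_ordSE normr_lattice_modn; apply/eqP.
rewrite -[RHS]N -[in RHS](Lk (x%:Z + 2)).
by have -> : x%:Z + 2 + k%:Z = (x + k)%N%:Z + 2 by lia.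
Qed.

(** Rotation invariance of [T] makes the triangle counts, hence the quiddity sequence, invariant
    under translation by k, and the quiddity sequence determines the frieze. *)
Lemma rotate_frieze_period (k : nat) : rotate_triangulation k T = T ->
  frieze_period F k.
Proof.
move=> rT; apply/frieze_period_quiddityP; have [_ aT] := assoc.
have n3 := order_ge3 F.
have Fq (q : nat) (j : int) : F (j + (q * n)%N%:Z) (j + (q * n)%N%:Z) = F j j.
  elim: q => [|q IH]; first by rewrite mul0n addr0.
  by rewrite mulSn addnC PoszD addrA quiddity_periodic.
have base (v : 'I_n) : F (v.+1%:Z + k%:Z) (v.+1%:Z + k%:Z) = F v.+1 v.+1.
  rewrite [RHS]aT -(triangles_at_imset v rT) -aT iter_ordSE.
  rewrite -[RHS](Fq ((v + k) %/ n)%N).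
  suff -> : v.+1%:Z + k%:Z
      = ((v + k) %% n).+1%:Z + ((v + k) %/ n * n)%N%:Z by [].
  have := divn_eq (v + k) n.
  move: ((v + k) %/ n * n)%N ((v + k) %% n)%N => a b; lia.
apply: (@int_period_ind _ n 1) => [|j|r Hr]; first by lia.
  have -> : j + n%:Z + k%:Z = j + k%:Z + n%:Z by ring.
  by rewrite !quiddity_periodic.
have rn : (absz r < n)%N by lia.
by have -> : 1 + r = (Ordinal rn).+1%:Z by [rewrite /=; lia]; exact: base.
Qed.

End AssociatedTriangulation.

(** * Growth sequences and rotational symmetry *)

Theorem corollary4p2 (n : nat) (F : frieze n) :
  [\/ growth_sequence F =1 growth2,
      growth_sequence F =1 growth4 |
      growth_sequence F =1 growth6]
  /\ (forall T : {set {set 'I_n}}, associated_triangulation F T ->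
      [/\ growth_sequence F =1 growth2 <-> no_rotational_symmetry T,
          growth_sequence F =1 growth4 <-> rotational_symmetry 2 T &
          growth_sequence F =1 growth6 <-> rotational_symmetry 3 T]).
Proof.
have n3 := order_ge3 F; have [p0 Fp _] := min_periodP F.
have order := frieze_symmetry_order F.
(* The growth sequence is determined by its term at 1; that each candidate obeys the same recurrence
   is checked on residues of k. *)
have g2 : growth_sequence F 1 = -2 <-> growth_sequence F =1 growth2.
  split=> [t|->//]; apply: growth_sequence_unique => // k.
  rewrite /growth2 /repeat_seq /= -[k.+2]addn2 -[k.+1]addn1 -!(modnDml k) /=.
  by have := ltn_pmod k (isT : 0 < 2)%N; case: (k %% 2)%N => [|[|]].
have g4 : growth_sequence F 1 = 0 <-> growth_sequence F =1 growth4.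
  split=> [t|->//]; apply: growth_sequence_unique => // k.
  rewrite /growth4 /repeat_seq /= -[k.+2]addn2 -[k.+1]addn1 -!(modnDml k) /=.
  by have := ltn_pmod k (isT : 0 < 4)%N; case: (k %% 4)%N => [|[|[|[|]]]].
have g6 : growth_sequence F 1 = 1 <-> growth_sequence F =1 growth6.
  split=> [t|->//]; apply: growth_sequence_unique => // k.
  rewrite /growth6 /repeat_seq /= -[k.+2]addn2 -[k.+1]addn1 -!(modnDml k) /=.
  have := ltn_pmod k (isT : 0 < 6)%N.
  by case: (k %% 6)%N => [|[|[|[|[|[|]]]]]].
split=> [|T assoc].
  case: order => [] [_] => [/g2|/g4|/g6] H;
    by [constructor 1|constructor 2|constructor 3].
(* The rotations preserving [T] are exactly those by multiples of the minimal period. *)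
have rotP (k : nat) : rotate_triangulation k T = T <-> (min_period F %| k)%N.
  split=> [/(rotate_frieze_period assoc)/min_period_dvd //|/dvdnP[q ->]].
  apply: (frieze_period_rotate assoc); apply/frieze_period_quiddityP.
  elim: q => [|q IH] j; first by rewrite mul0n addr0.
  by rewrite mulSn addnC PoszD addrA (frieze_period_quiddity Fp) IH.
have pE := rotP (min_period F); rewrite dvdnn in pE.
split; rewrite -?g2 -?g4 -?g6.
- split=> [t k /andP[k0 kn] /rotP /(dvdn_leq k0)|nosym].
    case: order => [] [nE]; rewrite ?t // => _; lia.
  case: order => [] [nE] t //; case: (nosym (min_period F));
    rewrite ?pE //; lia.
- split=> [t|[k [nk /rotP/dvdnP[c kE]]]].
    exists (min_period F); split; last exact/pE.
    by case: order => [] [nE]; rewrite t.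
  (* Half a turn is a rotation by a multiple of the minimal period, so the quotient of n by that
     period is even; among 1, 2 and 3 only 2 remains. *)
  have cE (d : nat) : n = (d * min_period F)%N -> d = (2 * c)%N.
    by move=> nE; apply/eqP; rewrite -(eqn_pmul2r p0) -mulnA -kE nk -nE.
  case: order => [] [nE] t //; first by have := cE 1%N; rewrite mul1n; lia.
  by have := cE 3%N nE; lia.
- split=> [t|[k [nk /rotP/dvdnP[c kE]]]].
    exists (min_period F); split; last exact/pE.
    by case: order => [] [nE]; rewrite t.
  (* Likewise the quotient is now divisible by 3, which excludes 1 and 2. *)
  have cE (d : nat) : n = (d * min_period F)%N -> d = (3 * c)%N.
    by move=> nE; apply/eqP; rewrite -(eqn_pmul2r p0) -mulnA -kE nk -nE.
  case: order => [] [nE] t //; first by have := cE 1%N; rewrite mul1n; lia.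
  by have := cE 2%N nE; lia.
Qed.
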